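(* Suppose $A=[A_1,\dots,A_n]\in\mathbb{R}^{N\times N}$ is non-singular, where $A_i\in\mathbb{R}^{N\times d_i}$ and $\sum_{i=1}^n d_i=N$. Let $\Gamma$ be the set of permutations of $\{1,\dots,n\}$ and define $$Q=E_\sigma(L_\sigma^{-1})=\frac1{n!}\sum_{\sigma\in\Gamma}L_\sigma^{-1},$$ with $L_\sigma$ as in the context. Then all eigenvalues of $QA^TA$ lie in $(0,4/3)$, i.e. $\mathrm{eig}(QA^TA)\subseteq(0,\tfrac43)$.
   Context: For $\sigma\in\Gamma$, $L_\sigma\in\mathbb{R}^{N\times N}$ is the $n\times n$ block matrix (block sizes $d_1,\dots,d_n$) with blocks $$L_\sigma[\sigma(i),\sigma(j)]=\begin{cases}A_{\sigma(i)}^TA_{\sigma(j)},&j\le i,\\0,&j>i.\end{cases}$$ $\mathrm{eig}(X)$ denotes the set of (complex) eigenvalues of $X$. *)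

(* Defs.v *)
From mathcomp Require Import all_boot all_order all_algebra all_fingroup.
From mathcomp Require Import reals.
From mathcomp Require Import complex.

Set Implicit Arguments.
Unset Strict Implicit.
Unset Printing Implicit Defensive.

Import Order.TTheory GRing.Theory Num.Theory.

Local Open Scope ring_scope.

(* Blocks are numbered from 0, so s : 'S_n is a bijection from positions to
   block indices, and (s^-1)%g k is the position of block k under s. *)
Definition Lmx (R : realType) (n : nat) (d : 'I_n -> nat)
    (A_ : forall j : 'I_n, 'M[R]_(\sum_(i < n) d i, d j)) (s : 'S_n) :
    'M[R]_(\sum_(i < n) d i) :=
  \mxblock_(k < n, l < n)
    (if ((s^-1)%g l <= (s^-1)%g k)%N then (A_ k)^T *m A_ l else 0).

Lemma submxblock_Lmx (R : realType) (n : nat) (d : 'I_n -> nat)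
    (A_ : forall j : 'I_n, 'M[R]_(\sum_(i < n) d i, d j)) (s : 'S_n)
    (i j : 'I_n) :
  submxblock (Lmx A_ s) (s i) (s j) =
    if (j <= i)%N then (A_ (s i))^T *m A_ (s j) else 0.
Proof. by rewrite /Lmx mxblockK !permK. Qed.

Definition Qmx (R : realType) (n : nat) (d : 'I_n -> nat)
    (A_ : forall j : 'I_n, 'M[R]_(\sum_(i < n) d i, d j)) :
    'M[R]_(\sum_(i < n) d i) :=
  (n`!%:R)^-1 *: \sum_(s : 'S_n) invmx (Lmx A_ s).

Definition eig (R : realType) (N : nat) (X : 'M[R]_N) : pred R[i] :=
  eigenvalue (map_mx (real_complex R) X).

(* Main.v *)
Require Import Defs.
From mathcomp Require Import all_boot all_order all_algebra all_fingroup.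
From mathcomp Require Import reals.
From mathcomp Require Import complex.
From mathcomp Require Import ring lra.

Set Implicit Arguments.
Unset Strict Implicit.
Unset Printing Implicit Defensive.

Import Order.TTheory GRing.Theory Num.Theory.

Local Open Scope ring_scope.
Local Open Scope complex_scope.

(** Let [P_k] be the orthogonal projector onto the column space of [A_k] and
    [F_k = 1 - P_k].  Solving with [L_s] is one sweep of block Gauss-Seidel,
    which in the space of residuals is a product of the [F_k]: with [s]
    listing the blocks as s(0), ..., s(n-1),
      [A L_s^-1 A^T = 1 - F_(s(n-1)) ... F_(s(0))]   ([Lmx_resolvent]).
    Hence [H = A Q A^T], which is similar to [Q A^T A], equals [1 - M_S], where
    [S] is the set of all blocks and [M_S] is the average over all orderings
    of [S] of the product of the [F_k] ([mul_A_Qmx_tr]).  This [H] is symmetric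
    because reversing an ordering transposes the product, so its eigenvalues
    are real, and it remains to bound its quadratic form.

    The bound goes by induction on [S] ([symavg_spectrum43]).  Sorting the
    orderings by their first block gives
      [M_S = 1/#|S| sum_(k in S) F_k M_(S - k)],
    so the form of [1 - M_S] is the mean of the forms of [1 - F_k (1 - B)] with
    [B = 1 - M_(S - k)].  At [x = u + v], where [u = x F_k] and [v = x P_k],
    and with [w = u B], such a form is [|v|^2 + <w,u> + <w,v>], and
      [4/3 |x|^2 - (|v|^2 + <w,u> + <w,v>)
         = 3/4 |w - 4/3 u - 2/3 v|^2 + (<w,u> - 3/4 |w|^2)].
    The last bracket is the value at [u] of the form of [B - 3/4 B^2], which is
    nonnegative as soon as the spectrum of [B] lies between 0 and
    4/3, and if it lies below 4/3 the bracket is positive unless [w = 0].  Thus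
    the strict bound 4/3 reproduces itself ([project_step]), starting from
    [B = 0] for the empty set of blocks.

    The same computation shows that the form vanishes at [x] only if
    [x P_k = 0] for every [k], that is, if [x] is orthogonal to the columns of
    every block; since [A] is invertible, this forces [x = 0] and gives the
    strict lower bound. *)

(** * Euclidean inner product of row vectors *)

Definition dot (R : realFieldType) (N : nat) (u v : 'rV[R]_N) : R :=
  (u *m v^T) 0 0.

Lemma dot_mulmx (R : realFieldType) (m n : nat)
    (u : 'rV[R]_m) (B : 'M[R]_(m, n)) (v : 'rV[R]_n) :
  dot (u *m B) v = dot u (v *m B^T).
Proof. by rewrite /dot trmx_mul trmxK mulmxA. Qed.

Section Dot.
Variables (R : realFieldType) (N : nat).
Implicit Types (u v w : 'rV[R]_N) (B : 'M[R]_N).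

Lemma dotE u v : dot u v = \sum_i u 0 i * v 0 i.
Proof. by rewrite /dot mxE; apply: eq_bigr => i _; rewrite mxE. Qed.

Lemma dotC u v : dot u v = dot v u.
Proof. by rewrite !dotE; apply: eq_bigr => i _; rewrite mulrC. Qed.

Lemma dotDl u v w : dot (u + v) w = dot u w + dot v w.
Proof. by rewrite /dot mulmxDl mxE. Qed.

Lemma dotDr u v w : dot w (u + v) = dot w u + dot w v.
Proof. by rewrite dotC dotDl !(dotC w). Qed.

Lemma dotZl a u w : dot (a *: u) w = a * dot u w.
Proof. by rewrite /dot -scalemxAl mxE. Qed.

Lemma dotZr a u w : dot w (a *: u) = a * dot w u.
Proof. by rewrite dotC dotZl dotC. Qed.

Lemma dotNl u w : dot (- u) w = - dot u w.
Proof. by rewrite -scaleN1r dotZl mulN1r. Qed.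

Lemma dotNr u w : dot w (- u) = - dot w u.
Proof. by rewrite dotC dotNl dotC. Qed.

Lemma dot0l w : dot 0 w = 0.
Proof. by rewrite /dot mul0mx mxE. Qed.

Definition dotE_lin := (dotDl, dotDr, dotZl, dotZr, dotNl, dotNr).

Lemma dot_suml (I : Type) (r : seq I) (F : I -> 'rV[R]_N) w :
  dot (\sum_(i <- r) F i) w = \sum_(i <- r) dot (F i) w.
Proof. by rewrite /dot mulmx_suml summxE. Qed.

Lemma dot_ge0 u : 0 <= dot u u.
Proof. by rewrite dotE; apply: sumr_ge0 => i _; rewrite -expr2 sqr_ge0. Qed.

Lemma dot_eq0 u : (dot u u == 0) = (u == 0).
Proof.
apply/idP/eqP => [|->]; last by rewrite dot0l.
rewrite dotE psumr_eq0 => [/allP u0|i _]; last by rewrite -expr2 sqr_ge0.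
apply/rowP => i; have := u0 i (mem_index_enum i).
by rewrite mulf_eq0 orbb mxE => /eqP.
Qed.

Lemma dot_gt0 u : (0 < dot u u) = (u != 0).
Proof. by rewrite lt_def dot_eq0 dot_ge0 andbT. Qed.

(** * Symmetric forms between 0 and 4/3 *)

(** For a symmetric matrix this says that the spectrum lies in [0, 4/3[;
    the wording by the quadratic form is the one that survives averaging. *)
Definition spectrum43 B : Prop :=
  [/\ B^T = B, forall x, 0 <= dot (x *m B) x
    & forall x, x != 0 -> dot (x *m B) x < 4 / 3 * dot x x].

Lemma spectrum43_le B x : spectrum43 B ->
  dot (x *m B) x <= 4 / 3 * dot x x.
Proof.
case=> _ _ ltB; have [->|/ltB/ltW//] := eqVneq x 0.
by rewrite mul0mx !dot0l mulr0.
Qed.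

(** This is [B - 3/4 B^2 >= 0].  With [c = 4/3], the two psd matrices [B] and
    [c - B] add up to [c], so [c B (c - B) = B (c - B) B + (c - B) B (c - B)]
    is a sum of two congruences of psd matrices; the first is definite off the
    kernel of [B], whence the strict inequality. *)
Lemma spectrum43_cocoercive B x (w := x *m B) : spectrum43 B ->
  3 / 4 * dot w w <= dot w x /\ (w != 0 -> 3 / 4 * dot w w < dot w x).
Proof.
move=> sB; have [symB posB ltB] := sB.
have swap : dot (w *m B) x = dot w w by rewrite dot_mulmx symB.
(* the term (c - B) B (c - B); the other one is [spectrum43_le] at [w] *)
have := posB (4 / 3 *: x - w).
rewrite mulmxBl -scalemxAl -/w !dotE_lin swap => ge0.
have := spectrum43_le w sB => leB.
split=> [|/ltB ltw]; lra.
Qed.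

(** The step that makes 4/3 self-reproducing: if [u] and [v] are the components
    of [x] in the kernel and the image of an orthogonal projector [P], then [q]
    is the form at [x] of [1 - (1 - P) (1 - B)]. *)
Lemma project_step B u v : dot u v = 0 -> spectrum43 B ->
  let q := dot (u *m B + v) (u + v) in
  [/\ 0 <= q, q = 0 -> v = 0
    & u + v != 0 -> q < 4 / 3 * dot (u + v) (u + v)].
Proof.
move=> uv0 sB q; set w := u *m B in q *.
have [le_w lt_w] := spectrum43_cocoercive u sB; rewrite -/w in le_w lt_w.
have qE : q = dot v v + dot w u + dot w v.
  by rewrite /q !dotE_lin (dotC v u) uv0; ring.
have w2 := dot_ge0 w.
(* [q = |v + w/2|^2 + (<w,u> - |w|^2/4)] handles the lower bound *)
have sq1 := dot_ge0 (v + 1 / 2 *: w).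
rewrite !dotE_lin (dotC v w) in sq1.
split; first by lra.
  move=> q0; have w20 : dot w w = 0 by lra.
  have w0 : w = 0 by apply/eqP; rewrite -dot_eq0 w20.
  move: qE; rewrite q0 w0 !dot0l => v20.
  by apply/eqP; rewrite -dot_eq0; apply/eqP; lra.
move=> x0; rewrite qE !dotE_lin (dotC v u) uv0.
case: (eqVneq w 0) => [w0|/lt_w {}lt_w].
  have := dot_gt0 (u + v); rewrite x0 !dotE_lin (dotC v u) uv0 w0 !dot0l.
  by have := dot_ge0 u; have := dot_ge0 v; lra.
(* the square completing [4/3 |u + v|^2 - q] *)
have := dot_ge0 (w - 4 / 3 *: u - 2 / 3 *: v).
rewrite !dotE_lin (dotC u w) (dotC v w) (dotC v u) uv0.
lra.
Qed.
End Dot.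

(** * Averages of ordered products *)

Section SymAvg.
Variables (R : realFieldType) (N : nat) (I : eqType).
Implicit Types (F P : I -> 'M[R]_N) (s t : seq I).

Definition mxprod F t : 'M[R]_N := \prod_(k <- t) F k.

Lemma mxprod_nil F : mxprod F [::] = 1%:M.
Proof. exact: big_nil. Qed.

Lemma mxprod_cons F k t : mxprod F (k :: t) = F k *m mxprod F t.
Proof. exact: big_cons. Qed.

Lemma mxprod_rcons F k t : mxprod F (rcons t k) = mxprod F t *m F k.
Proof. by rewrite /mxprod big_rcons. Qed.

Definition symavg F s : 'M[R]_N :=
  ((size s)`!%:R)^-1 *: \sum_(t <- permutations s) mxprod F t.

Lemma tr_mxprod F t : (forall k, (F k)^T = F k) ->
  (mxprod F t)^T = mxprod F (rev t).
Proof.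
move=> symF; elim: t => [|k t IH].
  by rewrite mxprod_nil trmx1.
by rewrite rev_cons mxprod_rcons mxprod_cons trmx_mul IH symF.
Qed.

(** Reversal is a bijection of the set of orderings. *)
Lemma tr_symavg F s : (forall k, (F k)^T = F k) ->
  (symavg F s)^T = symavg F s.
Proof.
move=> symF; rewrite /symavg linearZ /= linear_sum /=; congr (_ *: _).
under eq_bigr do rewrite tr_mxprod //.
rewrite -(big_map rev xpredT (mxprod F)); apply/perm_big/uniq_perm => [||t].
- by rewrite map_inj_uniq ?permutations_uniq //; apply: inv_inj revK.
- exact: permutations_uniq.
rewrite -{1}(revK t) mem_map ?mem_permutations ?perm_rev //.
exact: inv_inj revK.
Qed.

(** Orderings are sorted by their first element. *)
Lemma symavg_rec F s : uniq s -> (0 < size s)%N ->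
  symavg F s =
    ((size s)%:R)^-1 *: \sum_(k <- s) F k *m symavg F (rem k s).
Proof.
move=> Us s0; rewrite /symavg (perm_big _ (permutationsE s0)) undup_id //=.
rewrite big_allpairs_dep /= !scaler_sumr; apply: eq_big_seq => k ks.
under eq_bigr do rewrite mxprod_cons.
rewrite -mulmx_sumr -scalemxAr scalerA size_rem //; congr (_ *: _).
by rewrite -[in LHS](prednK s0) factS prednK // natrM invfM.
Qed.

(** The induction described at the top.  The kernel statement is what later
    excludes the eigenvalue 0, since it identifies where the form of [M] can
    vanish. *)
Lemma symavg_spectrum43 P s (M := 1%:M - symavg (fun k => 1%:M - P k) s) :
    (forall k, (P k)^T = P k) -> (forall k, P k *m P k = P k) -> uniq s ->
  spectrum43 M /\
  forall x, dot (x *m M) x = 0 -> {in s, forall k, x *m P k = 0}.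
Proof.
move=> symP idP; pose F k := 1%:M - P k.
have symF k : (F k)^T = F k by rewrite /F linearB /= trmx1 symP.
rewrite {}/M -/F; have [m] := ubnP (size s).
elim: m s => // m IH s; rewrite ltnS => le_sm Us.
have [s_nil|s_gt0] := posnP (size s).
  rewrite (size0nil s_nil) /symavg /permutations /= big_seq1 mxprod_nil.
  rewrite fact0 invr1 scale1r subrr; split; last by move=> x _ k.
  split=> [|x|x x0]; rewrite ?trmx0 ?mulmx0 ?dot0l //.
  by rewrite mulr_gt0 ?divr_gt0 ?ltr0n ?dot_gt0.
have c_gt0 : 0 < ((size s)%:R)^-1 :> R by rewrite invr_gt0 ltr0n.
pose q k x := dot (x *m F k *m (1%:M - symavg F (rem k s)) + x *m P k) x.
have qE x : dot (x *m (1%:M - symavg F s)) x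
    = ((size s)%:R)^-1 * \sum_(k <- s) q k x.
  have -> : x *m (1%:M - symavg F s) = ((size s)%:R)^-1 *:
      \sum_(k <- s) (x *m F k *m (1%:M - symavg F (rem k s)) + x *m P k).
    rewrite symavg_rec //.
    have oneE : 1%:M = ((size s)%:R)^-1 *: \sum_(k <- s) 1%:M :> 'M[R]_N.
      rewrite big_const_seq count_predT iter_addr_0 -scaler_nat scalerA.
      by rewrite mulVf ?scale1r // pnatr_eq0 -lt0n.
    rewrite [in LHS]oneE -scalerBr -sumrB -scalemxAr mulmx_sumr; congr (_ *: _).
    apply: eq_bigr => k _; rewrite mulmxBr mulmx1.
    rewrite (mulmxBr (x *m _)) mulmx1 mulmxA.
    by rewrite addrAC; congr (_ - _); rewrite -mulmxDr subrK mulmx1.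
  by rewrite dotZl dot_suml.
have step k x : k \in s -> [/\ 0 <= q k x, q k x = 0 -> x *m P k = 0
    & x != 0 -> q k x < 4 / 3 * dot x x].
  move=> ks; have [||spk _] := IH (rem k s).
  - by rewrite size_rem // prednK.
  - exact: rem_uniq.
  have uv0 : dot (x *m F k) (x *m P k) = 0.
    rewrite dot_mulmx symF -mulmxA mulmxBr mulmx1 idP subrr mulmx0.
    by rewrite dotC dot0l.
  have := project_step uv0 spk.
  by have -> : x *m F k + x *m P k = x by rewrite -mulmxDr subrK mulmx1.
split=> [|x /eqP]; last first.
  rewrite qE mulf_eq0 gt_eqF //= => /eqP sum0 k ks.
  have [q_ge0 q_eq0 _] := step k x ks; apply: q_eq0.
  apply/eqP; rewrite eq_le q_ge0 andbT -sum0 (big_rem k) //= lerDl.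
  by rewrite big_seq sumr_ge0 // => j /mem_rem js; have [] := step j x js.
split=> [|x|x x0].
- by rewrite linearB /= trmx1 tr_symavg.
- rewrite qE mulr_ge0 ?(ltW c_gt0) // big_seq sumr_ge0 // => k ks.
  by have [] := step k x ks.
set c := 4 / 3 * dot x x.
have -> : c = ((size s)%:R)^-1 * \sum_(k <- s) c.
  rewrite big_const_seq count_predT iter_addr_0 -(mulr_natl c) mulrA.
  by rewrite mulVf ?mul1r // pnatr_eq0 -lt0n.
rewrite qE ltr_pM2l // big_seq [ltRHS]big_seq; apply: ltr_sum.
  by apply/hasP; case: (s) s_gt0 => // k r _; exists k; rewrite mem_head.
by move=> k ks; have [_ _ ->] := step k x ks.
Qed.
End SymAvg.

(** Permutations of ['I_n] correspond to orderings of its elements; they inject,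
    and both sets have [n`!] elements. *)
Lemma sum_perm_seqs (V : nmodType) n (f : seq 'I_n -> V) :
  \sum_(s : 'S_n) f [seq s i | i <- enum 'I_n] =
  \sum_(t <- permutations (enum 'I_n)) f t.
Proof.
pose seq_of (s : 'S_n) := [seq s i | i <- enum 'I_n].
transitivity (\sum_(t <- codom seq_of) f t); first by rewrite big_image.
apply: perm_big.
have inj_seq : injective seq_of.
  move=> s s' /eq_in_map eqs; apply/permP => i.
  by apply: eqs; rewrite mem_enum.
have Uim : uniq (codom seq_of).
  by rewrite map_inj_uniq ?enum_uniq.
have sub : {subset codom seq_of <= permutations (enum 'I_n)}.
  move=> _ /codomP[s ->]; rewrite mem_permutations; apply: uniq_perm.
  - by rewrite map_inj_uniq ?enum_uniq //; apply: perm_inj.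
  - exact: enum_uniq.
  move=> i; rewrite mem_enum; apply/mapP.
  by exists (s^-1%g i); rewrite ?mem_enum ?permKV.
apply: uniq_perm => //; first exact: permutations_uniq.
have [|_ //] := uniq_min_size Uim sub.
by rewrite size_permutations ?enum_uniq // size_codom size_enum_ord card_Sn.
Qed.

(** * Orthogonal projectors onto column spaces *)

Section Projector.
Variables (R : realFieldType) (N d : nat) (A : 'M[R]_(N, d)).

Definition projector : 'M[R]_N := A *m invmx (A^T *m A) *m A^T.

Lemma tr_projector : projector^T = projector.
Proof.
by rewrite /projector !trmx_mul trmxK trmx_inv trmx_mul trmxK mulmxA.
Qed.

(** [v A^T A = 0] gives [|v A^T|^2 = 0], and [A^T] has a right inverse. *)
Lemma gram_unit (C : 'M[R]_(d, N)) : C *m A = 1%:M -> A^T *m A \in unitmx.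
Proof.
move=> CA; rewrite -row_free_unit; apply: inj_row_free => v v0.
have /eqP : dot (v *m A^T) (v *m A^T) = 0.
  by rewrite dot_mulmx trmxK -mulmxA v0 dotC dot0l.
rewrite dot_eq0 => /eqP vA0.
by rewrite -[v]mulmx1 -trmx1 -CA trmx_mul mulmxA vA0 mul0mx.
Qed.

Hypothesis A_unit : A^T *m A \in unitmx.

Lemma mulmx_tr_projector : A^T *m projector = A^T.
Proof. by rewrite /projector !mulmxA mulmxV // mul1mx. Qed.

Lemma projector_idem : projector *m projector = projector.
Proof. by rewrite {1}/projector -mulmxA mulmx_tr_projector. Qed.

Lemma projector_eq0 (x : 'rV[R]_N) : x *m projector = 0 -> x *m A = 0.
Proof.
move=> x0; apply: trmx_inj.
rewrite trmx_mul -mulmx_tr_projector -mulmxA -tr_projector -trmx_mul x0.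
by rewrite !trmx0 mulmx0.
Qed.
End Projector.

(** * Block Gauss-Seidel as a product of projectors *)

Section GaussSeidel.
Variables (R : realType) (n : nat) (d : 'I_n -> nat).
Variable A_ : forall j : 'I_n, 'M[R]_(\sum_(i < n) d i, d j).
Let A : 'M[R]_(\sum_(i < n) d i) := \mxrow_(j < n) A_ j.
Hypothesis hA : A \in unitmx.

Local Notation P k := (projector (A_ k)).
Local Notation F := (fun k => 1%:M - P k).

(** The rows of [A^-1] indexed by block [k] are a left inverse of [A_ k]. *)
Lemma block_gram_unit k : (A_ k)^T *m A_ k \in unitmx.
Proof.
apply: (@gram_unit _ _ _ _ (submxcol (invmx A) k)).
have := congr1 (fun M => submxblock M k k) (mulVmx hA).
rewrite -{1}(submxcolK (invmx A)) /A mul_mxcol_mxrow mxblockK => ->.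
apply/matrixP => i j; rewrite !mxE.
by rewrite -val_eqE tagnat.eq_Rank eqxx.
Qed.

(** Forward substitution: [L_s Y = A^T] is solved by the blocks
    [Y k = (A_k^T A_k)^-1 A_k^T Pi], where [Pi] is the product of the [F] of the
    blocks preceding [k].  Indeed [A_k Y k = P_k Pi] is the difference of two
    successive products, so the partial sums of the [A_l Y l] telescope.  As
    [A^T] is invertible, so is [L_s]. *)
Lemma Lmx_resolvent (s : 'S_n) :
  Lmx A_ s \in unitmx /\
  A *m invmx (Lmx A_ s) *m A^T
    = 1%:M - (mxprod F [seq s i | i <- enum 'I_n])^T.
Proof.
set t := [seq s i | i <- enum 'I_n].
have size_t : size t = n by rewrite size_map size_enum_ord.
(* The transpose puts the factor of the first block on the right. *)
pose Pi m := (mxprod F (take m t))^T.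
have Pi0 : Pi 0%N = 1%:M by rewrite /Pi take0 mxprod_nil trmx1.
have PiS (p : 'I_n) : Pi p.+1 = (1%:M - P (s p)) *m Pi p.
  rewrite /Pi (take_nth (s p)) ?size_t // mxprod_rcons trmx_mul.
  rewrite (nth_map p) ?size_enum_ord // nth_ord_enum.
  by rewrite linearB /= trmx1 tr_projector.
pose Y k := invmx ((A_ k)^T *m A_ k) *m (A_ k)^T *m Pi (s^-1%g k).
have partial m : (m <= n)%N ->
    \sum_(l < n | ((s^-1)%g l < m)%N) A_ l *m Y l = 1%:M - Pi m.
  move=> le_mn.
  transitivity (\sum_(p < n | (p < m)%N) (Pi p - Pi p.+1)).
    rewrite [LHS](reindex_inj (@perm_inj _ s)) /=.
    apply: eq_big => p; rewrite permK // => _.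
    rewrite PiS /Y permK !mulmxA -/(P (s p)).
    by rewrite mulmxBl mul1mx opprB addrC subrK.
  rewrite -(big_ord_widen _ (fun p => Pi p - Pi p.+1) le_mn).
  rewrite -(big_mkord xpredT (fun p => Pi p - Pi p.+1)).
  rewrite -Pi0 -(opprB (Pi m)) -telescope_sumr // -sumrN.
  by apply: eq_bigr => p _; rewrite opprB.
have LY : Lmx A_ s *m \mxcol_k Y k = A^T.
  rewrite /Lmx mul_mxblock_mxrow /A tr_mxrow; apply: eq_mxcol => k.
  transitivity ((A_ k)^T *m
      \sum_(l < n | ((s^-1)%g l < ((s^-1)%g k).+1)%N) A_ l *m Y l).
    rewrite mulmx_sumr [RHS]big_mkcond /=; apply: eq_bigr => l _.
    by rewrite ltnS; case: ifP; rewrite ?mul0mx // mulmxA.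
  rewrite partial // PiS permKV mulmxBr mulmx1 mulmxA mulmxBr mulmx1.
  by rewrite mulmx_tr_projector ?block_gram_unit // subrr mul0mx subr0.
have AT_unit : A^T \in unitmx by rewrite unitmx_tr.
have L_unit : Lmx A_ s \in unitmx.
  have : Lmx A_ s *m (\mxcol_k Y k *m invmx A^T) = 1%:M.
    by rewrite mulmxA LY mulmxV.
  by case/mulmx1_unit.
split=> //; rewrite -mulmxA -LY mulKmx // /A mul_mxrow_mxcol.
have := partial n (leqnn n); rewrite /Pi take_oversize ?size_t // => <-.
by apply: eq_bigl => l; rewrite ltn_ord.
Qed.

Lemma mul_A_Qmx_tr : A *m Qmx A_ *m A^T = 1%:M - symavg F (enum 'I_n).
Proof.
have symF k : (1%:M - P k)^T = 1%:M - P k.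
  by rewrite linearB /= trmx1 tr_projector.
rewrite -(tr_symavg (F := F) _ symF) /Qmx /symavg size_enum_ord -sum_perm_seqs.
have nf0 : (n`!%:R : R) != 0 by rewrite pnatr_eq0 -lt0n fact_gt0.
have mean1 : (n`!%:R)^-1 *: \sum_(s : 'S_n) 1%:M
    = 1%:M :> 'M[R]_(\sum_(i < n) d i).
  by rewrite sumr_const card_Sn -scaler_nat scalerA mulVf ?scale1r.
transitivity ((n`!%:R)^-1 *: \sum_(s : 'S_n)
    (1%:M - (mxprod F [seq s i | i <- enum 'I_n])^T)).
  rewrite -scalemxAr -scalemxAl mulmx_sumr mulmx_suml; congr (_ *: _).
  by apply: eq_bigr => s _; rewrite (Lmx_resolvent s).2.
rewrite sumrB scalerBr mean1; congr (_ - _).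
by rewrite [RHS]linearZ; congr (_ *: _); rewrite [RHS]linear_sum.
Qed.

End GaussSeidel.

(** * From the quadratic form to complex eigenvalues *)

Section Spectrum.
Variables (R : realType) (N : nat).

(** Writing an eigenvector as [a + i b] and the eigenvalue as [x + i y], the
    symmetry of [H] gives [y (|a|^2 + |b|^2) = 0]; then [a] or [b] is a real
    eigenvector for [x], and [x] is a value of the Rayleigh quotient. *)
Lemma eig_spectrum43 (H : 'M[R]_N) (z : R[i]) : spectrum43 H ->
    (forall x, dot (x *m H) x = 0 -> x = 0) -> z \in eig H ->
  exists2 x : R, 0 < x < 4 / 3 & z = x%:C.
Proof.
move=> [symH posH ltH] kerH /eigenvalueP[v vH v0].
case: z vH => x y vH.
pose a := map_mx (@complex.Re R) v; pose b := map_mx (@complex.Im R) v.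
have part (f : R[i] -> R) (f_add : {morph f : p q / p + q}) (f0 : f 0 = 0)
    (fM : forall p c, f (p * c%:C) = f p * c) :
    map_mx f v *m H = map_mx f (v *m map_mx (real_complex R) H).
  apply/rowP => j; rewrite !mxE (big_morph f f_add f0).
  by apply: eq_bigr => i _; rewrite !mxE fM.
have aH : a *m H = x *: a - y *: b.
  rewrite [LHS](part (@complex.Re R)) //; first last.
  - by move=> [p q] c /=; rewrite mulr0 subr0.
  - by move=> [p q] [p' q'].
  by rewrite vH; apply/rowP => j; rewrite !mxE; case: (v 0 j).
have bH : b *m H = y *: a + x *: b.
  rewrite [LHS](part (@complex.Im R)) //; first last.
  - by move=> [p q] c /=; rewrite mulr0 add0r.
  - by move=> [p q] [p' q'].
  by rewrite vH; apply/rowP => j; rewrite !mxE addrC; case: (v 0 j).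
have ab0 : a = 0 -> b = 0 -> v = 0.
  move=> /rowP a0 /rowP b0; apply/rowP => j.
  move: (a0 j) (b0 j); rewrite !mxE.
  by case: (v 0 j) => p q /= -> ->.
have y0 : y = 0.
  have : dot (a *m H) b = dot (b *m H) a by rewrite dot_mulmx symH dotC.
  rewrite aH bH !dotE_lin (dotC b a) => e.
  have e2 : y * (dot a a + dot b b) = 0 by lra.
  have/eqP := e2; rewrite mulf_eq0 => /orP[/eqP//|].
  rewrite paddr_eq0 ?dot_ge0 // !dot_eq0 => /andP[/eqP a0 /eqP b0].
  by rewrite (ab0 a0 b0) eqxx in v0.
have [c c0 cH] : exists2 c : 'rV[R]_N, c != 0 & c *m H = x *: c.
  have [a0|a0] := eqVneq a 0; last by exists a; rewrite // aH y0 scale0r subr0.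
  exists b; last by rewrite bH y0 scale0r add0r.
  by apply: contraNneq v0 => b0; rewrite (ab0 a0 b0).
exists x; last by rewrite y0.
have c_gt0 : 0 < dot c c by rewrite dot_gt0.
have := ltH c c0; have := posH c; rewrite cH dotZl ltr_pM2r // => ge0 ->.
rewrite andbT lt_def -(pmulr_lge0 _ c_gt0) ge0 andbT.
apply: contra c0 => /eqP x0; apply/eqP/kerH.
by rewrite cH x0 scale0r dot0l.
Qed.

Lemma eig_similar (A Q : 'M[R]_N) (z : R[i]) : A \in unitmx ->
  z \in eig (Q *m A^T *m A) -> z \in eig (A *m Q *m A^T).
Proof.
move=> A_unit /eigenvalueP[v vQ v0].
have AC_unit : map_mx (real_complex R) A \in unitmx by rewrite map_unitmx.
apply/eigenvalueP; exists (v *m invmx (map_mx (real_complex R) A)).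
  rewrite !map_mxM !mulmxA mulmxKV // scalemxAl -vQ !map_mxM !mulmxA.
  by rewrite mulmxK.
apply: contraNneq v0 => v'0.
by rewrite -[v](mulmxKV AC_unit) v'0 mul0mx.
Qed.
End Spectrum.

(** * The eigenvalue bound *)

Theorem lemma2 (R : realType) (n : nat) (d : 'I_n -> nat)
    (A_ : forall j : 'I_n, 'M[R]_(\sum_(i < n) d i, d j))
    (hA : (\mxrow_(j < n) A_ j) \in unitmx) :
  let A : 'M[R]_(\sum_(i < n) d i) := \mxrow_(j < n) A_ j in
  forall z : R[i], z \in eig (Qmx A_ *m A^T *m A) ->
    exists2 x : R, 0 < x < 4 / 3 & z = x%:C.
Proof.
move=> A z /(eig_similar hA); rewrite /A mul_A_Qmx_tr //.
have [spec ker] := symavg_spectrum43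
  (fun k => tr_projector (A_ k))
  (fun k => projector_idem (block_gram_unit hA k)) (enum_uniq 'I_n).
apply: eig_spectrum43 => // x /ker xP.
suff : x *m A = 0 by move/(canRL (mulmxK hA)); rewrite mul0mx.
rewrite /A mul_mxrow; apply/mxrowP => k; rewrite mxrowK submxrow0.
by apply/projector_eq0/xP; rewrite ?block_gram_unit ?mem_enum.
Qed.
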